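(* For every integer $d\ge 1$ there is a constant $c_d>0$ depending only on $d$ such that the following holds. Let $P\in\mathbb{Z}[X]$ be a polynomial of degree $d$ with height $\mathrm{H}(P)$, and let $\alpha,\beta\in\mathbb{C}$ be two of its roots such that $\Re\alpha\neq\Re\beta$. Then $$|\Re\alpha-\Re\beta|\ge c_d\cdot\begin{cases} \mathrm{H}(P)^{-(d-1)} & \text{if both } \alpha \text{ and } \beta \text{ are real},\\ \mathrm{H}(P)^{-3(d-1)(d-2)/2} & \text{if exactly one of } \alpha,\beta \text{ is real},\\ \mathrm{H}(P)^{-(d-1)(d-2)(d-3)/2} & \text{if neither } \alpha \text{ nor } \beta \text{ is real}. \end{cases}$$
   Context: The height $\mathrm{H}(P)$ of a polynomial $P$ is the maximum of the absolute values of its coefficients. *)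

(* Defs.v *)
From mathcomp Require Import all_boot all_order all_algebra.
From mathcomp Require Import reals complex.
Set Implicit Arguments.
Unset Strict Implicit.
Unset Printing Implicit Defensive.
Import Order.TTheory GRing.Theory Num.Theory.
Local Open Scope ring_scope.

Definition height (P : {poly int}) : nat :=
  (\max_(i < size P) `|(P`_i)%R|)%N.

(* The natural-number subtractions are truncated; for d >= 1 this is harmless,
   since a product in which some factor d - j would be negative also has a
   factor equal to 0. The divisions by 2 are exact. *)
Definition exponent_real_real (d : nat) : nat := (d - 1)%N.
Definition exponent_real_nonreal (d : nat) : nat :=
  (3 * (d - 1) * (d - 2) %/ 2)%N.
Definition exponent_nonreal_nonreal (d : nat) : nat :=
  ((d - 1) * (d - 2) * (d - 3) %/ 2)%N.

(* Main.v *)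
Require Import Defs.
From mathcomp Require Import all_boot all_order all_algebra.
From mathcomp Require Import reals complex.
From mathcomp Require Import perm mpoly ring.
Set Implicit Arguments.
Unset Strict Implicit.
Unset Printing Implicit Defensive.
Import Order.TTheory GRing.Theory Num.Theory.
Local Open Scope ring_scope.
(* Let a be the leading coefficient of P and x_1, ..., x_d its roots, with
   multiplicity. For an integer linear form f in k variables, let t run over the
   k-tuples of distinct indices. The product of the X - f(x_t) has coefficients that
   are symmetric in the x_i and of degree at most D = k (d-1)...(d-k+1) in each of
   them, so a^D clears their denominators; looking at the lowest nonzero
   coefficient, |a|^D times the product of the nonzero |f(x_t)| is at least 1.
   If m of the tuples give the same value delta of |f(x_t)|, bounding the other
   factors through |a| prod (1 + |x_i|) = O(H(P)) gives
   delta^m >= c H(P)^-D, that is, delta >= c' H(P)^-(D/m).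
   The three cases are x - y with m = 2, 2 x - y - conj y with m = 2, and
   x + conj x - y - conj y with m = 8. *)

(** * Bounding the roots by the coefficients *)

(** The coefficients of [q] satisfy a two-term recurrence, run downwards from the top if [|x| <= 1]
    and upwards from the constant term if [|x| > 1], so that errors are never amplified. The 2 comes
    from [1 + |x| <= 2 max(1, |x|)]. *)
Lemma size_div_XsubC_coef_le (C : numFieldType) (x h : C) (q : {poly C}) :
  0 <= h -> (forall i, `|(('X - x%:P) * q)`_i| <= h) ->
  forall j, (1 + `|x|) * `|q`_j| <= (2 * size q)%:R * h.
Proof.
move=> h_ge0 hP j; set P := _ * q in hP.
have coefP0 : P`_0 = - (x * q`_0).
  by rewrite /P mulrBl coefB coefXM coefCM sub0r.
have coefPS i : P`_i.+1 = q`_i - x * q`_i.+1.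
  by rewrite /P mulrBl coefB coefXM coefCM.
have [le_qj|lt_jq] := leqP (size q) j.
  by rewrite nth_default // normr0 mulr0 mulr_ge0 ?ler0n.
have [x_le1|x_ge1] := real_leP (normr_real x) (@real1 C).
  have le_q m i : (size q <= i + m)%N -> `|q`_i| <= m%:R * h.
    elim: m i => [|m IHm] i.
      by rewrite addn0 => /leq_sizeP/(_ i (leqnn _)) ->; rewrite normr0 mul0r.
    rewrite addnS -addSn => /IHm le_qiS.
    have -> : q`_i = P`_i.+1 + x * q`_i.+1 by rewrite coefPS subrK.
    apply: le_trans (ler_normD _ _) _; rewrite mulrSr mulrDl mul1r addrC.
    apply: lerD => //; apply: le_trans le_qiS.
    by rewrite normrM ler_piMl.
  rewrite natrM -mulrA; apply: ler_pM => //.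
  - by rewrite addr_ge0.
  - by rewrite mulr2n lerD.
  by apply: le_q; rewrite leq_addl.
have x_ge1' := ltW x_ge1.
have le_xq i : `|x| * `|q`_i| <= i.+1%:R * h.
  elim: i => [|i IHi]; first by rewrite mul1r -normrM -normrN -coefP0.
  have -> : `|x| * `|q`_i.+1| = `|q`_i - P`_i.+1|.
    by rewrite coefPS opprB addrC subrK normrM.
  apply: le_trans (ler_normB _ _) _; rewrite mulrSr mulrDl mul1r.
  apply: lerD => //; apply: le_trans IHi.
  by rewrite ler_peMl.
apply: (@le_trans _ _ (2 * (`|x| * `|q`_j|))).
  by rewrite mulrA ler_wpM2r // mulr2n mulrDl mul1r lerD2r.
rewrite natrM -mulrA ler_wpM2l ?ler0n //.
by apply: le_trans (le_xq j) _; rewrite ler_wpM2r // ler_nat.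
Qed.

(** A Landau-type inequality with a crude constant: roots are split off one at a time, and each
    division gains [1 + |x|] at the cost of a factor depending only on the degree. *)
Lemma lead_prod_roots_le (C : numFieldType) (a h : C) (s : seq C) :
  0 <= h -> (forall i, `|(a *: \prod_(x <- s) ('X - x%:P))`_i| <= h) ->
  `|a| * \prod_(x <- s) (1 + `|x|) <= (2 ^ size s * (size s).+1`!)%:R * h.
Proof.
elim: s h => [|x s IHs] h h_ge0.
  by rewrite !big_nil => /(_ 0%N); rewrite coefZ coef1 !mulr1 mul1r.
rewrite !big_cons scalerAr; set q := _ *: _ => le_h.
have x_gt0 : 0 < 1 + `|x| by rewrite ltr_pwDl.
(* [q] has size at most [(size s).+1]; the looser [(size s).+2] makes the factors multiply up to the
   factorial. *)
have le_q i : `|q`_i| <= (2 * (size s).+2)%:R * h / (1 + `|x|).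
  rewrite ler_pdivlMr // mulrC.
  apply: le_trans (size_div_XsubC_coef_le h_ge0 le_h i) _.
  rewrite ler_wpM2r // ler_nat leq_mul2l /=.
  by apply: leq_trans (size_scale_leq _ _) _; rewrite size_prod_XsubC.
have := IHs _ (le_trans (normr_ge0 _) (le_q 0%N)) le_q.
rewrite mulrA ler_pdivlMr // => le_prod.
rewrite mulrCA mulrC; apply: le_trans le_prod _.
rewrite mulrA -natrM ler_wpM2r // ler_nat /= expnS (factS (size s).+1).
by rewrite mulnACA [(2 ^ _ * 2)%N]mulnC [(_`! * _)%N]mulnC.
Qed.

(** * Degree of a multivariate polynomial in a single variable *)

(** The degree in each variable separately, rather than the total degree, governs how many powers of
    the leading coefficient clear denominators. The zero polynomial satisfies every bound. *)
Definition var_deg_le n (R : nzRingType) (j : 'I_n) D (p : {mpoly R[n]}) :=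
  {in msupp p, forall m : 'X_{1..n}, (m j <= D)%N}.

Lemma var_deg_leW n (R : nzRingType) (j : 'I_n) D E (p : {mpoly R[n]}) :
  (D <= E)%N -> var_deg_le j D p -> var_deg_le j E p.
Proof. by move=> le_DE le_p m /le_p/leq_trans; apply. Qed.

Lemma var_deg_leC n (R : nzRingType) (j : 'I_n) D (c : R) :
  var_deg_le j D c%:MP.
Proof.
by move=> m; rewrite msuppC; case: eqP => // _; rewrite inE => /eqP->; rewrite mnm0E.
Qed.

Lemma var_deg_leD n (R : nzRingType) (j : 'I_n) D (p q : {mpoly R[n]}) :
  var_deg_le j D p -> var_deg_le j D q -> var_deg_le j D (p + q).
Proof.
by move=> le_p le_q m /msuppD_le; rewrite mem_cat => /orP[/le_p|/le_q].
Qed.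

Lemma var_deg_le_sum n (R : nzRingType) (j : 'I_n) D I (r : seq I) (P : pred I)
    (F : I -> {mpoly R[n]}) :
  (forall i, P i -> var_deg_le j D (F i)) ->
  var_deg_le j D (\sum_(i <- r | P i) F i).
Proof.
move=> le_F; elim/big_rec: _ => [|i p /le_F Fi IHp]; first by move=> m; rewrite msupp0.
exact: var_deg_leD.
Qed.

Lemma var_deg_leZ n (R : nzRingType) (j : 'I_n) D (c : R) (p : {mpoly R[n]}) :
  var_deg_le j D p -> var_deg_le j D (c *: p).
Proof. by move=> le_p m /msuppZ_le/le_p. Qed.

Lemma var_deg_leM n (R : nzRingType) (j : 'I_n) D E (p q : {mpoly R[n]}) :
  var_deg_le j D p -> var_deg_le j E q -> var_deg_le j (D + E) (p * q).
Proof.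
move=> le_p le_q m /msuppM_le/allpairsP[[m1 m2] [/= /le_p m1D /le_q m2E ->]].
by rewrite mnmDE leq_add.
Qed.

Lemma var_deg_leX n (R : nzRingType) (j : 'I_n) D k (p : {mpoly R[n]}) :
  var_deg_le j D p -> var_deg_le j (D * k) (p ^+ k).
Proof.
move=> le_p; elim: k => [|k IHk]; first exact: var_deg_leC.
by rewrite exprS mulnS; apply: var_deg_leM.
Qed.

Lemma var_deg_le_mesym n (R : nzRingType) (j : 'I_n) k :
  var_deg_le j 1 (mesym n R k).
Proof. by move=> m; rewrite mem_msupp_mesym => /andP[_ /forallP]. Qed.

Lemma var_deg_le_prod n (R : nzRingType) (j : 'I_n) I (r : seq I) (P : pred I)
    (D : I -> nat) (F : I -> {mpoly R[n]}) :
  (forall i, P i -> var_deg_le j (D i) (F i)) ->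
  var_deg_le j (\sum_(i <- r | P i) D i) (\prod_(i <- r | P i) F i).
Proof.
move=> le_F; elim/big_rec2: _ => [|i p D' /le_F Fi IHp]; first exact: var_deg_leC.
exact: var_deg_leM.
Qed.

(** * Integrality of symmetric functions of the roots *)

Definition integral_value (R : pzRingType) (x : R) := exists z : int, x = z%:~R.

Lemma integral_valueM (R : pzRingType) (x y : R) :
  integral_value x -> integral_value y -> integral_value (x * y).
Proof. by move=> [z ->] [t ->]; exists (z * t); rewrite intrM. Qed.

Lemma integral_valueX (R : pzRingType) (x : R) k :
  integral_value x -> integral_value (x ^+ k).
Proof. by move=> [z ->]; exists (z ^+ k); rewrite rmorphXn. Qed.

Lemma integral_value_prod (R : pzRingType) I (r : seq I) (P : pred I) (F : I -> R) :
  (forall i, P i -> integral_value (F i)) ->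
  integral_value (\prod_(i <- r | P i) F i).
Proof.
move=> FZ; elim/big_rec: _ => [|i x /FZ Fi xZ]; first by exists 1.
exact: integral_valueM.
Qed.

Lemma mmap_mesym (R : comNzRingType) n k (h : 'I_n -> R) :
  mmap intr h (mesym n int k) = (mesym n R k).@[h].
Proof.
rewrite /mesym !raddf_sum /=; apply/eq_bigr => i _.
rewrite !rmorph_prod /=; apply/eq_bigr => j _.
by rewrite mmapX mmap1U mevalXU.
Qed.

(** Vieta: up to sign the value is the coefficient of [P] at [n - k]; for [k > n] the elementary
    symmetric polynomial is zero. *)
Lemma lead_mesym_roots_int (F : idomainType) n (P : {poly int}) (r : n.-tuple F) k :
  map_poly intr P = (lead_coef P)%:~R *: \prod_(x <- r) ('X - x%:P) ->
  integral_value ((lead_coef P)%:~R * mmap intr (tnth r) (mesym n int k)).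
Proof.
move=> Pr; have [le_kn|lt_nk] := leqP k n; last first.
  by exists 0; rewrite mesym_geqnE // raddf0 mulr0.
have := congr1 (fun p : {poly F} => p`_(n - k)) Pr.
rewrite coefZ coef_map /= -[k in (n - k)%N]/(val (Ordinal (le_kn : k < n.+1)%N)).
rewrite mroots_coeff /= -mmap_mesym mulrCA => eqP.
exists ((-1) ^+ k * P`_(n - k)).
by rewrite intrM rmorphXn /= rmorphN1 eqP signrMK.
Qed.

(** The algorithm of the fundamental theorem of symmetric polynomials, by induction on the leading
    monomial. The subtracted product of elementary symmetric polynomials and the remainder both keep
    degree at most [D] in each variable. *)
Lemma sym_roots_int (F : idomainType) n D (P : {poly int}) (r : n.-tuple F)
    (p : {mpoly int[n]}) :
  map_poly intr P = (lead_coef P)%:~R *: \prod_(x <- r) ('X - x%:P) ->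
  p \is symmetric -> (forall j, var_deg_le j D p) ->
  integral_value ((lead_coef P)%:~R ^+ D * mmap intr (tnth r) p).
Proof.
move=> Pr; elim/mleadrect: p => p IHp symp degp.
have [->|p_neq0] := eqVneq p 0; first by exists 0; rewrite raddf0 mulr0.
have := symf1P symp; set S := [tuple _ | _ < _].
rewrite /symf1 (negPf p_neq0) /=.
set c := nth 0%N (mlead p); set E := [multinom _ | _ < n].
set q := p - _ => /and3P[q_lt q_sym /eqP p_eq].
(* The exponents of the elementary symmetric functions telescope to the largest
   exponent of the leading monomial, so at most D powers of the leading
   coefficient are needed. *)
have sumE : (\sum_i E i <= D)%N.
  have c_dec i : (c i.+1 <= c i)%N.
    have [le_ni|lt_in] := leqP n i.+1; first by rewrite {1}/c nth_default ?size_tuple.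
    have := mlead_msym_sorted symp (leqnSn i : Ordinal (ltnW lt_in) <= Ordinal lt_in)%N.
    by rewrite !(mnm_nth 0%N).
  rewrite (eq_bigr (fun i : 'I_n => c i - c i.+1)%N) => [|i _]; last by rewrite mnmE.
  have sumcE k : (\sum_(i < k) (c i - c i.+1) + c k = c 0)%N.
    elim: k => [|k IHk]; first by rewrite big_ord0.
    by rewrite big_ord_recr /= -addnA subnK.
  apply: (@leq_trans (c 0)); first by rewrite -(sumcE n) leq_addr.
  rewrite /c; case: (posnP n) => [n0|n_gt0].
    by rewrite nth_default // size_tuple n0.
  have := degp (Ordinal n_gt0) _ (mlead_supp p_neq0).
  by rewrite (mnm_nth 0%N).
have ES : 'X_[E] \mPo S = \prod_(i < n) mesym n int i.+1 ^+ E i.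
  by rewrite comp_mpolyX; apply: eq_bigr => i _; rewrite tnth_mktuple.
have degES j : var_deg_le j D ('X_[E] \mPo S).
  rewrite ES; apply: var_deg_leW sumE _.
  apply: var_deg_le_prod => i _.
  by have := @var_deg_leX _ _ _ _ (E i) _ (@var_deg_le_mesym n int j i.+1); rewrite mul1n.
have qZ : integral_value ((lead_coef P)%:~R ^+ D * mmap intr (tnth r) q).
  have [->|q_neq0] := eqVneq q 0; first by exists 0; rewrite raddf0 mulr0.
  apply: IHp => //; first by rewrite (negPf q_neq0) in q_lt.
  move=> j; apply: var_deg_leD => //; rewrite -scaleNr; exact: var_deg_leZ.
have ESZ : integral_value ((lead_coef P)%:~R ^+ D * mmap intr (tnth r) ('X_[E] \mPo S)).
  rewrite -(subnK sumE) exprD -mulrA; apply: integral_valueM.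
    by apply: integral_valueX; exists (lead_coef P).
  rewrite ES rmorph_prod /= -prodrXr -big_split /=.
  apply: integral_value_prod => i _; rewrite rmorphXn -exprMn.
  exact/integral_valueX/lead_mesym_roots_int.
case: qZ ESZ => [zq qE] [z zE]; exists (p@_(mlead p) * z + zq).
rewrite [in LHS]p_eq comp_mpolyZ mmapD mulrDr qE mmapZ mulrCA zE.
by rewrite intrD intrM.
Qed.

(** * Products of linear forms over injective tuples *)

(** The index is the number of [t] with [l t = 0]: these factors contribute that power of [X], and
    the coefficient there is the constant term of the other factors. *)
Lemma prod_XsubC_coef_neq0 (R : idomainType) (I : finType) (Q : pred I) (l : I -> R) :
  exists i, (\prod_(t | Q t) ('X - (l t)%:P))`_i = \prod_(t | Q t && (l t != 0)) - l t.
Proof.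
exists #|[pred t | Q t && (l t == 0)]|.
rewrite (bigID (fun t => l t == 0)) /= mulrC.
rewrite [X in _ * X](eq_bigr (fun=> 'X)) => [|t /andP[_ /eqP->]]; last by rewrite subr0.
rewrite prodr_const coefMXn ltnn subnn -horner_coef0 horner_prod.
by apply: eq_bigr => t _; rewrite hornerD hornerN hornerX hornerC add0r.
Qed.

(** Double counting: a transposition shows that the count is the same for all [j], and each of the
    [n ^_ k] injective tuples has exactly [k] entries. *)
Lemma card_uniq_tuples_containing n k (j : 'I_n) :
  (\sum_(t : k.-tuple 'I_n | uniq t) (j \in t) = k * (n - 1) ^_ (k - 1))%N.
Proof.
pose S i := (\sum_(t : k.-tuple 'I_n | uniq t) (i \in t))%N.
have SE i : S i = S j.
  rewrite /S (reindex_inj (h := map_tuple (tperm i j))) /=; last first.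
    by move=> t u /(congr1 val)/(inj_map perm_inj)/val_inj.
  apply: eq_big => t; first by rewrite map_inj_uniq //; exact: perm_inj.
  by move=> _; rewrite -[X in X \in _](tpermR i j) (mem_map (@perm_inj _ _)).
have nS : (n * S j = k * n ^_ k)%N.
  have -> : (n * S j = \sum_(i < n) S i)%N.
    by rewrite (eq_bigr (fun=> S j)) // sum_nat_const card_ord.
  rewrite exchange_big /= (eq_bigr (fun=> k)) => [|t tU].
    rewrite sum_nat_const mulnC; congr (_ * _)%N.
    rewrite -[in RHS](card_ord n) -(card_uniq_tuples k predT) cardsE.
    by apply: eq_card => t; rewrite !unfold_in all_predT.
  rewrite -[RHS](size_tuple t) -(card_uniqP tU) -sum1_card [RHS]big_mkcond /=.
  by apply: eq_bigr => i _; case: (i \in t).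
have n_gt0 : (0 < n)%N by apply: leq_ltn_trans (ltn_ord j).
apply/eqP; rewrite -(eqn_pmul2l n_gt0) nS; case: k {S SE nS} => [|k].
  by rewrite !mul0n muln0.
by rewrite ffactnS !subn1 /= mulnCA.
Qed.

Section LinearForms.
Variables (n k : nat) (f : k.-tuple int).

Definition lin_form (R : pzRingType) (x : 'I_n -> R) (t : k.-tuple 'I_n) : R :=
  \sum_(c < k) (tnth f c)%:~R * x (tnth t c).

Definition generic_form (t : k.-tuple 'I_n) : {mpoly int[n]} :=
  lin_form (fun i => 'X_i) t.

Definition forms_poly : {poly {mpoly int[n]}} :=
  \prod_(t : k.-tuple 'I_n | uniq t) ('X - (generic_form t)%:P).

Lemma mmap_generic_form (R : comNzRingType) (x : 'I_n -> R) t :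
  mmap intr x (generic_form t) = lin_form x t.
Proof.
rewrite raddf_sum /=; apply: eq_bigr => c _.
by rewrite rmorphM rmorph_int /= mmapX mmap1U.
Qed.

Lemma forms_poly_map (R : comNzRingType) (x : 'I_n -> R) :
  map_poly (mmap intr x) forms_poly =
  \prod_(t : k.-tuple 'I_n | uniq t) ('X - (lin_form x t)%:P).
Proof.
rewrite rmorph_prod /=; apply: eq_bigr => t _.
by rewrite rmorphB /= map_polyX map_polyC /= mmap_generic_form.
Qed.

(** A permutation [s] of the variables carries the form of [t] to that of [map_tuple s t], so it
    only permutes the factors. *)
Lemma forms_poly_sym i : forms_poly`_i \is symmetric.
Proof.
apply/issymP => s; rewrite -[LHS]/(msym s _) -coef_map; congr (polyseq _)`_i.
rewrite /forms_poly rmorph_prod /= [RHS](reindex_inj (h := map_tuple s)) /=; last first.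
  by move=> t u /(congr1 val)/(inj_map perm_inj)/val_inj.
apply: eq_big => t; first by rewrite map_inj_uniq //; exact: perm_inj.
move=> _; rewrite rmorphB /= map_polyX map_polyC /=; congr (_ - _%:P).
rewrite raddf_sum /=; apply: eq_bigr => c _.
rewrite rmorphM rmorph_int /= tnth_map; congr (_ * _).
by rewrite /msym mmapX mmap1U.
Qed.

(** The bound is 0 for tuples avoiding [j], so summing it counts only the tuples through [j], as in
    [card_uniq_tuples_containing]. *)
Lemma var_deg_le_generic_form j t : var_deg_le j (j \in t) (generic_form t).
Proof.
apply: var_deg_le_sum => c _.
have -> : (tnth f c)%:~R = (tnth f c)%:MP :> {mpoly int[n]}.
  by rewrite -[in RHS](intz (tnth f c)) rmorph_int.
rewrite -[X in var_deg_le _ X _]add0n; apply: var_deg_leM; first exact: var_deg_leC.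
move=> m; rewrite msuppX inE => /eqP->; rewrite mnm1E.
by case: eqP => // <-; rewrite mem_tnth.
Qed.

Lemma var_deg_le_forms_poly j i :
  var_deg_le j (k * (n - 1) ^_ (k - 1)) forms_poly`_i.
Proof.
rewrite -(card_uniq_tuples_containing k j) /forms_poly.
elim/big_rec2: _ i => [|t D p tU IHp] i.
  by rewrite coef1; case: (i == 0%N); [exact: var_deg_leC|move=> m; rewrite msupp0].
rewrite mulrBl coefB coefXM coefCM.
apply: var_deg_leD; last first.
  by rewrite -scaleN1r; apply/var_deg_leZ/var_deg_leM => //; exact: var_deg_le_generic_form.
case: (i == 0%N); first by move=> m; rewrite msupp0.
by apply: var_deg_leW (IHp _); rewrite leq_addl.
Qed.

(** The coefficient singled out by [prod_XsubC_coef_neq0], once cleared of denominators, is a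
    nonzero integer. *)
Lemma prod_lin_form_ge1 (C : numFieldType) (P : {poly int}) (r : n.-tuple C) :
  P != 0 ->
  map_poly intr P = (lead_coef P)%:~R *: \prod_(x <- r) ('X - x%:P) ->
  1 <= `|(lead_coef P)%:~R : C| ^+ (k * (n - 1) ^_ (k - 1)) *
    \prod_(t : k.-tuple 'I_n | uniq t && (lin_form (tnth r) t != 0))
       `|lin_form (tnth r) t|.
Proof.
move=> P_neq0 Pr.
have [i iE] := prod_XsubC_coef_neq0 (fun t : k.-tuple 'I_n => uniq t) (lin_form (tnth r)).
rewrite -forms_poly_map coef_map /= in iE.
have [z zE] := sym_roots_int Pr (forms_poly_sym i) (var_deg_le_forms_poly ^~ i).
rewrite iE in zE.
move: (congr1 Num.norm zE); rewrite normrM normrX normr_prod.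
under eq_bigr do rewrite normrN.
move=> ->.
have z_neq0 : z != 0.
  rewrite -(intr_eq0 C) -zE mulf_eq0 negb_or expf_neq0 ?intr_eq0 ?lead_coef_eq0 //=.
  by apply/prodf_neq0 => t /andP[_]; rewrite oppr_eq0.
by rewrite -intr_norm -[1]/(1%:~R) ler_int -gtz0_ge1 normr_gt0.
Qed.
End LinearForms.

(** * Lower bounds for values of linear forms in terms of the height *)

Lemma height_gt0 (P : {poly int}) : P != 0 -> (0 < height P)%N.
Proof.
move=> P_neq0; have P_gt0 : (0 < size P)%N by rewrite size_poly_gt0.
have lt_P : ((size P).-1 < size P)%N by rewrite prednK.
apply: leq_trans (leq_bigmax (Ordinal lt_P)).
by rewrite absz_gt0 /= -lead_coefE lead_coef_eq0.
Qed.

Lemma coef_le_height (C : numDomainType) (P : {poly int}) i :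
  `|(P`_i)%:~R : C| <= (height P)%:R.
Proof.
rewrite -intr_norm -abszE -pmulrn ler_nat.
have [le_Pi|lt_iP] := leqP (size P) i; first by rewrite nth_default.
exact: (leq_bigmax (Ordinal lt_iP)).
Qed.

Lemma prod_1Dnorm_ge1 (C : numDomainType) I (r : seq I) (P : pred I) (x : I -> C) :
  1 <= \prod_(i <- r | P i) (1 + `|x i|).
Proof.
apply: (big_ind (fun y => 1 <= y)) => // [y z|i _]; first exact: mulr_ege1.
by rewrite lerDl.
Qed.

(** Each [|x (tnth t c)|] is at most the whole product. The successor keeps the right side at least
    1 even for [f = 0], so the bound can also stand in for absent factors. *)
Lemma lin_form_norm_le (C : numDomainType) n k (f : k.-tuple int) (x : 'I_n -> C) t :
  `|lin_form f x t| <=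
    (\sum_(c < k) `|tnth f c|%N).+1%:R * \prod_(c < k) (1 + `|x (tnth t c)|).
Proof.
apply: le_trans (ler_norm_sum _ _ _) _.
rewrite -addn1 natrD natr_sum mulrDl mulr_suml mul1r.
rewrite -[leLHS]addr0; apply: lerD; last first.
  by apply: prodr_ge0 => c _; rewrite addr_ge0.
apply: ler_sum => c _; rewrite normrM -intr_norm -abszE -pmulrn.
apply: ler_wpM2l => //; rewrite (bigD1 c) //=.
apply: le_trans (_ : (1 + `|x (tnth t c)|) * 1 <= _).
  by rewrite mulr1 lerDr.
by apply: ler_wpM2l; rewrite ?addr_ge0 ?prod_1Dnorm_ge1.
Qed.

(** The leading coefficient and every [1 + |x i|] occur to the same power [m * e], so they combine
    into a power of [W], and an [m]-th root can be taken. *)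
Lemma form_separation (C : numFieldType) n k (f : k.-tuple int) m e :
  (0 < m)%N -> (m * e = k * (n - 1) ^_ (k - 1))%N ->
  exists2 c : nat, (0 < c)%N &
    forall (P : {poly int}) (r : n.-tuple C) (T : seq (k.-tuple 'I_n)) (delta : C),
      P != 0 ->
      map_poly intr P = (lead_coef P)%:~R *: \prod_(x <- r) ('X - x%:P) ->
      uniq T -> size T = m -> all (fun t : k.-tuple 'I_n => uniq t) T ->
      delta != 0 -> {in T, forall t, `|lin_form f (tnth r) t| = delta} ->
      (height P)%:R ^- e <= c%:R * delta.
Proof.
move=> m_gt0 meE.
pose B := (\sum_(c < k) `|tnth f c|%N).+1.
pose N := #|[pred t : k.-tuple 'I_n | uniq t]|.
pose K := (2 ^ n * n.+1`!)%N.
have K_gt0 : (0 < K)%N by rewrite muln_gt0 expn_gt0 fact_gt0.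
(* [B ^ N] collects the constants of [lin_form_norm_le] over all injective tuples; [K ^ e] comes
   from raising [W_le] to the power [e]. *)
exists (B ^ N * K ^ e)%N; first by rewrite muln_gt0 !expn_gt0 K_gt0.
move=> P r T delta P_neq0 Pr T_uniq Tm T_inj delta_neq0 Tdelta.
have H_gt0 := height_gt0 P_neq0.
set x := tnth r in Tdelta; set a : C := (lead_coef P)%:~R in Pr.
pose W := `|a| * \prod_(i < n) (1 + `|x i|).
have W_le : W <= K%:R * (height P)%:R.
  have := @lead_prod_roots_le C a (height P)%:R r (ler0n _ _).
  rewrite -Pr size_tuple big_tuple; apply=> i.
  by rewrite coef_map coef_le_height.
have delta_ge0 : 0 <= delta.
  case: T Tm Tdelta {T_uniq T_inj} => [m0|t T _ Tdelta]; first by rewrite -m0 in m_gt0.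
  by rewrite -(Tdelta t) ?mem_head.
have := prod_lin_form_ge1 f P_neq0 Pr.
rewrite -/x -/a (bigID (mem T)) /=.
(* The tuples of [T] do occur in the product: they are injective, and the form is nonzero on them
   because [delta != 0]. *)
rewrite (eq_bigl (mem T)) => [|t]; last first.
  rewrite /= andb_idl // => tT; rewrite (allP T_inj) //=.
  by rewrite -normr_eq0 (Tdelta t tT).
rewrite (eq_bigr (fun=> delta)) => [|t /Tdelta //].
rewrite -big_uniq //= big_const_seq count_predT Tm iter_mulr_1.
set rest := \prod_(t | _) _ => ge1.
have rest_le : rest <= B%:R ^+ N * (\prod_(i < n) (1 + `|x i|)) ^+ (m * e).
  (* The product may be extended to all injective tuples because the added factors are at least
     1. *)
  apply: (@le_trans _ _ (\prod_(t : k.-tuple 'I_n | uniq t)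
      (B%:R * \prod_(c < k) (1 + `|x (tnth t c)|)))).
    rewrite /rest big_mkcond [leRHS]big_mkcond /=; apply: ler_prod => t _.
    have G_ge1 : 1 <= B%:R * \prod_(c < k) (1 + `|x (tnth t c)|).
      by rewrite mulr_ege1 ?ler1n ?prod_1Dnorm_ge1.
    case: ifP => [/andP[/andP[-> _] _]|_].
      by rewrite normr_ge0 lin_form_norm_le.
    by rewrite ler01 /=; case: ifP => _; rewrite ?lexx.
  rewrite big_split /= prodr_const.
  (* Regrouping by index: [1 + |x i|] appears once for each injective tuple containing [i], hence
     [m * e] times. *)
  rewrite (eq_bigr (fun t : k.-tuple 'I_n => \prod_(i < n) (1 + `|x i|) ^+ (i \in t))).
    rewrite exchange_big /= -prodrXl le_eqVlt; apply/orP; left; apply/eqP; congr (_ * _).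
    by apply: eq_bigr => i _; rewrite prodrXr card_uniq_tuples_containing meE.
  move=> t tU; rewrite -(big_tuple _ _ t xpredT (fun i => 1 + `|x i|)).
  rewrite big_uniq //= big_mkcond; apply: eq_bigr => i _.
  by case: (i \in t).
(* [B ^ N] is weakened to its [m]-th power to make the right side a perfect [m]-th power. *)
have {}ge1 : 1 <= (delta * B%:R ^+ N * W ^+ e) ^+ m.
  apply: le_trans ge1 _; rewrite -meE !exprMn -!exprM -[(e * m)%N]mulnC.
  rewrite [leLHS]mulrCA -[leRHS]mulrA ler_wpM2l ?exprn_ge0 // [leRHS]mulrCA.
  rewrite ler_wpM2l ?exprn_ge0 //; apply: le_trans rest_le _.
  rewrite ler_wpM2r ?exprn_ge0 ?(le_trans ler01) ?prod_1Dnorm_ge1 //.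
  by rewrite ler_weXn2l ?ler1n // leq_pmulr.
rewrite expr_ge1 // in ge1; last first.
  by rewrite !mulr_ge0 ?exprn_ge0 ?mulr_ge0 // (le_trans ler01) ?prod_1Dnorm_ge1.
rewrite -[leLHS]mul1r ler_pdivrMr ?exprn_gt0 ?ltr0n //.
apply: le_trans ge1 _; rewrite natrM !natrX.
have -> : B%:R ^+ N * K%:R ^+ e * delta * (height P)%:R ^+ e =
          delta * B%:R ^+ N * (K%:R * (height P)%:R) ^+ e by rewrite exprMn; ring.
rewrite ler_wpM2l ?mulr_ge0 ?exprn_ge0 // lerXn2r ?nnegrE ?mulr_ge0 //.
by rewrite (le_trans ler01) ?prod_1Dnorm_ge1.
Qed.

(** Both signs are allowed because exchanging the roles of the two roots can negate the form; only
    absolute values matter. *)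
Lemma real_form_separation (R : rcfType) d k (f : k.-tuple int) m e :
  (0 < m)%N -> (m * e = k * (d - 1) ^_ (k - 1))%N ->
  exists2 c : R, 0 < c &
    forall (P : {poly int}) (r : d.-tuple R[i]) (T : seq (k.-tuple 'I_d)) (y : R),
      P != 0 ->
      map_poly intr P = (lead_coef P)%:~R *: \prod_(x <- r) ('X - x%:P) ->
      uniq T -> size T = m -> all (fun t : k.-tuple 'I_d => uniq t) T ->
      y != 0 ->
      {in T, forall t, lin_form f (tnth r) t = y%:C%C \/
                       lin_form f (tnth r) t = - y%:C%C} ->
      c * (height P)%:R ^- e <= `|y|.
Proof.
move=> m_gt0 meE.
have [c c_gt0 cP] := @form_separation R[i] d k f m e m_gt0 meE.
exists (c%:R^-1); first by rewrite invr_gt0 ltr0n.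
move=> P r T y P_neq0 Pr T_uniq Tm T_inj y_neq0 Ty.
have norm_yC : `|y%:C%C| = `|y|%:C%C :> R[i].
  by rewrite normc_def /= expr0n addr0 sqrtr_sqr.
have := cP P r T `|y|%:C%C P_neq0 Pr T_uniq Tm T_inj.
rewrite ler_pdivrMl ?ltr0n // -lecR !rmorphM fmorphV rmorphXn /= !rmorph_nat.
apply; first by rewrite -norm_yC normr_eq0 fmorph_eq0.
by move=> t /Ty [] ->; rewrite ?normrN norm_yC.
Qed.

(** * Roots of an integer polynomial and their conjugates *)

Lemma poly_roots_tuple (R : rcfType) d (P : {poly int}) :
  size P = d.+1 ->
  exists2 r : d.-tuple R[i],
    map_poly intr P = (lead_coef P)%:~R *: \prod_(x <- r) ('X - x%:P) &
    forall x, root (map_poly intr P) x -> exists i, tnth r i = x.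
Proof.
move=> sizeP; set p : {poly R[i]} := map_poly intr P.
have size_p : size p = d.+1 by rewrite size_map_inj_poly //; exact: intr_inj.
have [r p_r] := closed_field_poly_normal p.
have p_neq0 : lead_coef p != 0 by rewrite lead_coef_eq0 -size_poly_eq0 size_p.
have size_r : size r == d.
  by have := size_p; rewrite {1}p_r size_scale // size_prod_XsubC => -[->].
exists (Tuple size_r).
  by rewrite /= -/p p_r lead_coef_map_inj //; exact: intr_inj.
move=> x; rewrite p_r rootZ // root_prod_XsubC => x_r.
have /tnthP[i ->] : x \in Tuple size_r by [].
by exists i.
Qed.

Lemma root_conj_int (R : rcfType) (P : {poly int}) (x : R[i]) :
  root (map_poly intr P) x -> root (map_poly intr P) x^*%C.
Proof.
rewrite -complex_root_conj -map_poly_comp /=.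
by rewrite (eq_map_poly (g := intr)) // => z; rewrite /= rmorph_int.
Qed.

(** Over an explicit list the sum unfolds by computation once the tuples are concrete. *)
Lemma lin_form_zip (R : pzRingType) n k (f : k.-tuple int) (x : 'I_n -> R) t :
  lin_form f x t = \sum_(p <- zip f t) p.1%:~R * x p.2.
Proof.
rewrite -[zip f t]/(tval (zip_tuple f t)) big_tuple; apply: eq_bigr => c _.
(* [j] only supplies a default value for [nth]. *)
have j := tnth t c.
by rewrite !(tnth_nth (0, j)) /= nth_zip ?size_tuple // -!tnth_nth.
Qed.

(** * The three cases *)

(** Here [k = m = 2], so the exponent is half of [2 (d - 1)]; the two orders of the pair give
    opposite values. *)
Lemma real_real_separation (R : rcfType) d :
  exists2 c : R, 0 < c &
    forall (P : {poly int}) (alpha beta : R[i]),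
      size P = d.+1 ->
      root (map_poly intr P) alpha -> root (map_poly intr P) beta ->
      complex.Re alpha != complex.Re beta ->
      alpha \is Num.real -> beta \is Num.real ->
      c * (height P)%:R ^- exponent_real_real d
        <= `|complex.Re alpha - complex.Re beta|.
Proof.
have [|c c_gt0 cP] := @real_form_separation R d 2 [tuple 1; -1] 2
  (exponent_real_real d) isT.
  by rewrite ffactn1.
exists c => // P alpha beta sizeP Pa Pb neq_ab aR bR.
have P_neq0 : P != 0 by rewrite -size_poly_eq0 sizeP.
have [r Pr rP] := poly_roots_tuple R sizeP.
have [i ri] := rP _ Pa; have [j rj] := rP _ Pb.
have ij : i != j by apply: contra neq_ab => /eqP ij; rewrite -ri -rj ij.
apply: (cP P r [:: [tuple i; j]; [tuple j; i]]) => //.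
- by rewrite /= !inE -!val_eqE /= !eqseq_cons (negPf ij).
- by rewrite /= !inE ij eq_sym ij.
- by rewrite subr_eq0.
move=> t; rewrite rmorphB /= !RRe_real // !inE => /orP[] /eqP ->; [left|right].
all: rewrite lin_form_zip /= !big_cons big_nil /= ri rj.
all: by ring.
Qed.

(** The factors are consecutive, or the product is zero by truncation. This makes the halving in the
    other two exponents exact. *)
Lemma even_mul_pred d : (2 %| (d - 1) * (d - 2))%N.
Proof.
rewrite !subnS subn0 dvdn2 oddM; case: d.-1 => //= n.
by rewrite andNb.
Qed.

(** Here [k = 3] and [m = 2], so the exponent is half of [3 (d - 1) (d - 2)]; exchanging [beta] with
    its conjugate preserves the value. *)
Lemma real_nonreal_separation (R : rcfType) d :
  exists2 c : R, 0 < c &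
    forall (P : {poly int}) (alpha beta : R[i]),
      size P = d.+1 ->
      root (map_poly intr P) alpha -> root (map_poly intr P) beta ->
      complex.Re alpha != complex.Re beta ->
      alpha \is Num.real -> beta \isn't Num.real ->
      c * (height P)%:R ^- exponent_real_nonreal d
        <= `|complex.Re alpha - complex.Re beta|.
Proof.
have [|c c_gt0 cP] := @real_form_separation R d 3 [tuple 2; -1; -1] 2
  (exponent_real_nonreal d) isT.
  rewrite /exponent_real_nonreal -(mulnA 3) mulnC divnK; last exact/dvdn_mull/even_mul_pred.
  by rewrite ffactnS ffactn1 !subnS subn0.
(* The form takes twice the difference of the real parts, hence the halved constant. *)
exists (c / 2); [by rewrite divr_gt0|move=> P alpha beta sizeP Pa Pb neq_ab aR bR].
have P_neq0 : P != 0 by rewrite -size_poly_eq0 sizeP.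
have [r Pr rP] := poly_roots_tuple R sizeP.
have [i ri] := rP _ Pa; have [j rj] := rP _ Pb.
have [j' rj'] := rP _ (root_conj_int Pb).
have ij : i != j by apply: contra neq_ab => /eqP ij; rewrite -ri -rj ij.
have ij' : i != j'.
  apply: contra bR => /eqP ij'; rewrite -[beta]conjcK -rj' -ij' ri.
  by rewrite -(RRe_real aR) conjc_real RRe_real.
have jj' : j != j'.
  apply: contra bR => /eqP jj'; apply/complex_realP; exists (complex.Re beta).
  by rewrite ReJ_add -rj' -jj' rj; field.
rewrite mulrAC ler_pdivrMr // [leRHS]mulrC.
have -> : 2 * `|complex.Re alpha - complex.Re beta| =
          `|2 * (complex.Re alpha - complex.Re beta)| by rewrite normrM ger0_norm.
apply: (cP P r [:: [tuple i; j; j']; [tuple i; j'; j]]) => //.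
- by rewrite /= !inE -!val_eqE /= !eqseq_cons (negPf jj') andbF.
- by rewrite /= !inE !negb_or ij ij' jj' eq_sym jj'.
- by rewrite mulf_neq0 ?pnatr_eq0 ?subr_eq0.
move=> t; rewrite rmorphM rmorphB rmorph_nat /= RRe_real // !inE ReJ_add.
move=> t_T; left; case/orP: t_T => /eqP ->.
all: rewrite lin_form_zip /= !big_cons big_nil /= ri rj rj'.
all: by field.
Qed.

(** Here [k = 4] and [m = 8], so the exponent is an eighth of [4 (d - 1) (d - 2) (d - 3)].
    Conjugation within either pair preserves the value (four tuples, [T1]), and exchanging the pairs
    negates it (four more, [T2]). *)
Lemma nonreal_nonreal_separation (R : rcfType) d :
  exists2 c : R, 0 < c &
    forall (P : {poly int}) (alpha beta : R[i]),
      size P = d.+1 ->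
      root (map_poly intr P) alpha -> root (map_poly intr P) beta ->
      complex.Re alpha != complex.Re beta ->
      alpha \isn't Num.real -> beta \isn't Num.real ->
      c * (height P)%:R ^- exponent_nonreal_nonreal d
        <= `|complex.Re alpha - complex.Re beta|.
Proof.
have [|c c_gt0 cP] := @real_form_separation R d 4 [tuple 1; 1; -1; -1] 8
  (exponent_nonreal_nonreal d) isT.
  rewrite /exponent_nonreal_nonreal -[8%N]/(4 * 2)%N -mulnA [(2 * _)%N]mulnC.
  rewrite divnK; last exact/dvdn_mulr/even_mul_pred.
  by rewrite !ffactnS ffactn0 muln1 !subnS subn0 !mulnA.
exists (c / 2); [by rewrite divr_gt0|move=> P alpha beta sizeP Pa Pb neq_ab aR bR].
have P_neq0 : P != 0 by rewrite -size_poly_eq0 sizeP.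
have [r Pr rP] := poly_roots_tuple R sizeP.
have [i ri] := rP _ Pa; have [j rj] := rP _ Pb.
have [i' ri'] := rP _ (root_conj_int Pa); have [j' rj'] := rP _ (root_conj_int Pb).
(* The four indices are distinct: real parts differ across the pairs, and nonreality separates each
   root from its conjugate. *)
have neq_re k l (x y : R[i]) : tnth r k = x -> tnth r l = y ->
    complex.Re x != complex.Re y -> k != l.
  by move=> <- <-; apply: contra => /eqP ->.
have re_conj (x : R[i]) : complex.Re x^*%C = complex.Re x by case: x.
have ij : i != j by apply: neq_re ri rj _.
have ij' : i != j' by apply: neq_re ri rj' _; rewrite re_conj.
have i'j : i' != j by apply: neq_re ri' rj _; rewrite re_conj.
have i'j' : i' != j' by apply: neq_re ri' rj' _; rewrite !re_conj.
have neq_conj k l (x : R[i]) : tnth r k = x -> tnth r l = x^*%C ->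
    x \isn't Num.real -> k != l.
  move=> rk rl; apply: contra => /eqP kl; apply/complex_realP; exists (complex.Re x).
  by rewrite ReJ_add -rl -kl rk; field.
have ii' := neq_conj _ _ _ ri ri' aR; have jj' := neq_conj _ _ _ rj rj' bR.
rewrite mulrAC ler_pdivrMr // [leRHS]mulrC.
have -> : 2 * `|complex.Re alpha - complex.Re beta| =
          `|2 * (complex.Re alpha - complex.Re beta)| by rewrite normrM ger0_norm.
pose T1 := [:: [tuple i; i'; j; j']; [tuple i'; i; j; j'];
               [tuple i; i'; j'; j]; [tuple i'; i; j'; j]].
pose T2 := [:: [tuple j; j'; i; i']; [tuple j; j'; i'; i];
               [tuple j'; j; i; i']; [tuple j'; j; i'; i]].
apply: (cP P r (T1 ++ T2)) => //.
- rewrite /= !inE -!val_eqE /= !eqseq_cons.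
  by rewrite !(eq_sym i' i) !(eq_sym j' j) (negPf ij) (negPf ij')
             (negPf i'j) (negPf i'j') (negPf ii') (negPf jj') ?andbF.
- rewrite /= !inE !negb_or !(eq_sym i' i) !(eq_sym j' j) !(eq_sym j i) !(eq_sym j i').
  rewrite !(eq_sym j' i) !(eq_sym j' i').
  by rewrite ij ij' i'j i'j' ii' jj'.
- by rewrite mulf_neq0 ?pnatr_eq0 ?subr_eq0.
move=> t; rewrite mem_cat rmorphM rmorphB rmorph_nat /= !ReJ_add.
case/orP=> t_T; [left|right]; move: t_T.
all: rewrite !inE => /or4P[] /eqP ->.
all: rewrite lin_form_zip /= !big_cons big_nil /= ri rj ri' rj'.
all: by field.
Qed.

Theorem theorem3 (R : realType) (d : nat) (hd : (1 <= d)%N) :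
  exists2 c : R, 0 < c &
    forall (P : {poly int}) (alpha beta : R[i]),
      size P = d.+1 ->
      root (map_poly intr P) alpha ->
      root (map_poly intr P) beta ->
      complex.Re alpha != complex.Re beta ->
      c * (if (alpha \is Num.real) && (beta \is Num.real) then
             (height P)%:R ^- exponent_real_real d
           else if (alpha \is Num.real) || (beta \is Num.real) then
             (height P)%:R ^- exponent_real_nonreal d
           else
             (height P)%:R ^- exponent_nonreal_nonreal d)
      <= `|complex.Re alpha - complex.Re beta|.
Proof.
have [c1 c1_gt0 c1P] := @real_real_separation R d.
have [c2 c2_gt0 c2P] := @real_nonreal_separation R d.
have [c3 c3_gt0 c3P] := @nonreal_nonreal_separation R d.
pose c := Num.min c1 (Num.min c2 c3).
have c_le1 : c <= c1 by rewrite ge_min lexx.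
have c_le2 : c <= c2 by rewrite !ge_min lexx orbT.
have c_le3 : c <= c3 by rewrite !ge_min lexx !orbT.
have Hge0 (P : {poly int}) e : 0 <= (height P)%:R ^- e :> R.
  by rewrite invr_ge0 exprn_ge0.
exists c => [|P alpha beta sizeP Pa Pb neq_ab]; first by rewrite !lt_min c1_gt0 c2_gt0.
have [aR|aNR] := boolP (alpha \is Num.real); have [bR|bNR] := boolP (beta \is Num.real).
- by apply: le_trans (c1P P _ _ sizeP Pa Pb neq_ab aR bR); rewrite ler_wpM2r.
- by apply: le_trans (c2P P _ _ sizeP Pa Pb neq_ab aR bNR); rewrite ler_wpM2r.
(* The mixed case expects the real root first, so the roots are exchanged. *)
- rewrite distrC; rewrite eq_sym in neq_ab.
  by apply: le_trans (c2P P _ _ sizeP Pb Pa neq_ab bR aNR); rewrite ler_wpM2r.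
- by apply: le_trans (c3P P _ _ sizeP Pa Pb neq_ab aNR bNR); rewrite ler_wpM2r.
Qed.
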